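(* Let $\Omega\subset\mathbb{R}^n$ be Lebesgue measurable, let $\mu$ be Lebesgue measure, let $(E,\|\cdot\|)$ be a nonzero Banach space, and let $u:\Omega\to\mathbb{R}$ be $\mu$-measurable. Then $$\left\|\int_\Omega f\,d\mu\right\|\le\int_\Omega u\,\|f\|\,d\mu\quad\text{for all } f\in L^1(\Omega\to E)$$ if and only if $u\ge 1$ $\mu$-a.e. on $\Omega$.
   Context: $L^1(\Omega\to E)$ denotes the space of strongly (Bochner) measurable, Bochner integrable functions $f:\Omega\to E$; $\int_\Omega f\,d\mu$ is the Bochner integral. Saying the inequality holds for $f$ includes that $\int_\Omega u\|f\|\,d\mu$ is well defined as an extended real number in $[-\infty,\infty]$ (the value $+\infty$ is allowed). *)

(* Defs.v *)
From HB Require Import structures.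
From mathcomp Require Import all_boot all_order all_algebra.
From mathcomp Require Import all_classical all_reals all_analysis.
From mathcomp Require Import measurable_realfun.

Set Implicit Arguments.
Unset Strict Implicit.
Unset Printing Implicit Defensive.

Import Order.TTheory GRing.Theory Num.Theory.
Import numFieldNormedType.Exports.

Local Open Scope classical_set_scope.
Local Open Scope ring_scope.

(* The product of Lebesgue measure on [R] and a measure [m] on [R^n], read on
   [R^(n+1)] through the identification [(x, t) |-> x :: t]. *)
Section tcons_measure.
Context {R : realType} (n : nat).
Local Notation T := (measurableTypeR R).

Definition tcons (x : T * n.-tuple T) : n.+1.-tuple T := [tuple of x.1 :: x.2].

Lemma measurable_tcons : measurable_fun [set: T * n.-tuple T] tcons.
Proof. by apply: measurable_cons. Qed.

Context (m : {sigma_finite_measure set (n.-tuple T) -> \bar R}).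

Definition tcons_measure : set (n.+1.-tuple T) -> \bar R :=
  pushforward (@lebesgue_measure R \x m)%E tcons.

Let tcons_measure0 : tcons_measure set0 = 0%E.
Proof. by rewrite /tcons_measure /pushforward preimage_set0 measure0. Qed.

Let tcons_measure_ge0 A : (0 <= tcons_measure A)%E.
Proof. by rewrite /tcons_measure /pushforward measure_ge0. Qed.

Let tcons_measure_sigma_additive : semi_sigma_additive tcons_measure.
Proof.
move=> F mF tF mUF; rewrite /tcons_measure /pushforward preimage_bigcup.
apply: measure_semi_sigma_additive.
- by move=> k; rewrite -[X in measurable X]setTI; exact: measurable_tcons.
- apply/trivIsetP => /= i j _ _ ij; rewrite -preimage_setI.
  by move/trivIsetP : tF => /(_ _ _ _ _ ij) ->//; rewrite preimage_set0.
- by rewrite -preimage_bigcup -[X in measurable X]setTI; exact: measurable_tcons.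
Qed.

HB.instance Definition _ := isMeasure.Build _ _ _ tcons_measure
  tcons_measure0 tcons_measure_ge0 tcons_measure_sigma_additive.

Let uncons (t : n.+1.-tuple T) : T * n.-tuple T :=
  (thead t, [tuple of behead t]).

Let tconsK : cancel tcons uncons.
Proof. by move=> [x t]; congr pair => //; apply/val_inj. Qed.

Let measurable_uncons : measurable_fun setT uncons.
Proof.
apply/measurable_fun_pairP; split; first exact: measurable_tnth.
exact: measurable_behead.
Qed.

Lemma tcons_measureX (A : set T) (B : set (n.-tuple T)) :
  measurable A -> measurable B ->
  tcons_measure [set t | A (thead t) /\ B [tuple of behead t]] =
  (lebesgue_measure A * m B)%E.
Proof.
move=> mA mB; rewrite -product_measure1E//; congr (product_measure1 _ _ _).
by rewrite -[RHS](preimage_id) -(funext tconsK : uncons \o tcons = id).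
Qed.

Let tcons_measure_sigma_finite : sigma_finite setT tcons_measure.
Proof.
have /sigma_finiteP[F [TF ndF Foo]] := sigma_finiteT (@lebesgue_measure R).
have /sigma_finiteP[G [TG ndG Goo]] := sigma_finiteT m.
exists (fun k => [set t | F k (thead t) /\ G k [tuple of behead t]]).
  apply/seteqP; split => // t _.
  have : setT (thead t) by []. rewrite TF => -[i _ Fi].
  have : setT [tuple of behead t] by []. rewrite TG => -[j _ Gj].
  exists (maxn i j) => //; split.
  - by move: (thead t) Fi; exact/subsetPset/ndF/leq_maxl.
  - by move: [tuple of behead t] Gj; exact/subsetPset/ndG/leq_maxr.
move=> k; have [mF Fk] := Foo k; have [mG Gk] := Goo k; split.
  rewrite (_ : mkset _ = uncons @^-1` (F k `*` G k))//.
  rewrite -[X in measurable X]setTI; apply: measurable_uncons => //.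
  exact: measurableX.
by rewrite tcons_measureX// lte_mul_pinfty// ge0_fin_numE.
Qed.

HB.instance Definition _ := Measure_isSigmaFinite.Build _ _ _ tcons_measure
  tcons_measure_sigma_finite.

End tcons_measure.

Fixpoint borel_lebesgue (R : realType) (n : nat) :
    {sigma_finite_measure set (n.-tuple (measurableTypeR R)) -> \bar R} :=
  match n with
  | 0 => \d_([tuple] : 0.-tuple (measurableTypeR R))
  | n'.+1 => tcons_measure (borel_lebesgue R n')
  end.

(* [Rn R n] is [R^n] with the sigma-algebra of Lebesgue measurable sets: the
   Caratheodory sigma-algebra of the outer measure induced by [borel_lebesgue],
   which is complete. *)
Definition Rn (R : realType) (n : nat) :=
  caratheodory_type ((borel_lebesgue R n)^*)%mu.

HB.instance Definition _ (R : realType) (n : nat) := Measurable.on (Rn R n).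

Definition lebesgue (R : realType) (n : nat) : set (Rn R n) -> \bar R :=
  @completed_measure_extension _ _ _ (borel_lebesgue R n).

HB.instance Definition _ (R : realType) (n : nat) := Measure.on (@lebesgue R n).

HB.instance Definition _ (R : realType) (n : nat) :=
  Measure_isSigmaFinite.Build _ _ _ (@lebesgue R n)
    (completed_measure_extension_sigma_finite
       (sigma_finiteT (borel_lebesgue R n))).

Lemma lebesgue_prod (R : realType) (n : nat)
    (A : 'I_n -> set (measurableTypeR R)) : (forall i, measurable (A i)) ->
  lebesgue [set t : Rn R n | forall i, A i (tnth t i)] =
  (\prod_(i < n) lebesgue_measure (A i))%E.
Proof.
move=> mA; pose box m (B : 'I_m -> set (measurableTypeR R)) :=
  [set t : m.-tuple (measurableTypeR R) | forall i, B i (tnth t i)].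
have mbox m B : (forall i, measurable (B i)) -> measurable (box m B).
  move=> mB; rewrite (_ : box m B = \bigcap_(i in [set: 'I_m])
      (fun t : m.-tuple (measurableTypeR R) => tnth t i) @^-1` B i); last first.
    by apply/seteqP; split => t /= Bt i; [move=> _|]; exact: Bt.
  apply: fin_bigcap_measurable => // i _; rewrite -[X in measurable X]setTI.
  by apply: measurable_tnth.
rewrite [LHS](_ : _ = borel_lebesgue R n (box n A)); last first.
  by apply: measurable_mu_extE; exact: mbox.
elim: n A mA => [|n ih] A mA /=.
  by rewrite big_ord0 diracE mem_set// => -[].
rewrite big_ord_recl -ih// -tcons_measureX//; last exact: mbox.
congr tcons_measure; apply/seteqP; split => t /= At.
  split; first exact: At.
  move=> i; rewrite tnth_behead (_ : inord _ = lift ord0 i); first exact: At.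
  by apply/val_inj; rewrite /= inordK// ltnS.
move=> i; have [j ->|->] := unliftP ord0 i; last exact: At.1.
have := At.2 j; rewrite tnth_behead (_ : inord _ = lift ord0 j)//.
by apply/val_inj; rewrite /= inordK// ltnS.
Qed.

Section bochner.
Context d (T : measurableType d) (R : realType).
Context (mu : {measure set T -> \bar R}) (E : normedModType R).
Implicit Types (D : set T) (f : T -> E).

Definition simple_on D (s : T -> E) : Prop :=
  finite_set (s @` D) /\ forall v, measurable (D `&` s @^-1` [set v]).

Definition integrable_simple_on D (s : T -> E) : Prop :=
  simple_on D s /\ forall v, v != 0 -> (mu (D `&` s @^-1` [set v]) < +oo)%E.

(* The value [v = 0], the only one that [s] may take on a set of infinite
   measure, does not contribute. *)
Definition simple_integral D (s : T -> E) : E :=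
  \sum_(v \in s @` D) fine (mu (D `&` s @^-1` [set v])) *: v.

Definition strongly_measurable D f : Prop :=
  exists2 s : nat -> T -> E, (forall k, simple_on D (s k)) &
    {ae mu, forall x, D x -> s k x @[k --> \oo] --> f x}.

Definition bochner_approx D f (s : nat -> T -> E) : Prop :=
  (forall k, integrable_simple_on D (s k)) /\
  (\int[mu]_(x in D) (`|f x - s k x|)%:E)%E @[k --> \oo] --> 0%E.

(* [L^1(D -> E)]; functions on [D] are represented by functions on [T], whose
   values outside [D] are irrelevant. *)
Definition bochner_integrable D f : Prop :=
  strongly_measurable D f /\ exists s, bochner_approx D f s.

(* The common limit of the integrals of all approximating sequences; a dummy
   value if [f] is not integrable. *)
Definition bochner_integral D f : E :=
  xget 0 [set I | exists2 s, bochner_approx D f s &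
                    simple_integral D (s k) @[k --> \oo] --> I].

(* Existence of [\int_D g dmu] in [[-oo, +oo]]: the positive and negative parts
   do not both have an infinite integral (the library's integral is total, with
   [+oo - oo = -oo]). *)
Definition integral_exists D (g : T -> \bar R) : Prop :=
  measurable_fun D g /\
  ((\int[mu]_(x in D) g^\+ x < +oo) \/ (\int[mu]_(x in D) g^\- x < +oo))%E.

End bochner.

(* Main.v *)
(* If u >= 1 a.e., then |int f| <= int |f| <= int u |f|, where the first
   inequality is a limit of the inequality for simple functions. Conversely,
   fix e != 0 and test the inequality on f = 1_B e, where B has finite measure
   and lies in {u <= 1 - 1/(k+1)}: it reads mu B |e| <= (1 - 1/(k+1)) mu B |e|,
   so mu B = 0, and by sigma-finiteness countably many such B cover {u < 1}. *)
Require Import Defs.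
From HB Require Import structures.
From mathcomp Require Import all_boot all_order all_algebra.
From mathcomp Require Import all_classical all_reals all_analysis.
From mathcomp Require Import measurable_realfun.

Import Order.TTheory GRing.Theory Num.Theory.
Import numFieldNormedType.Exports.

Local Open Scope classical_set_scope.
Local Open Scope ring_scope.

Set Implicit Arguments.
Unset Strict Implicit.

(** * Functions with finitely many values on [D] and measurable fibers *)

Section finitely_valued.
Local Open Scope ereal_scope.
Context d (T : measurableType d) (R : realType) (mu : {measure set T -> \bar R}).
Context (D : set T) (W : choiceType) (p : T -> W).
Context (finp : finite_set (p @` D)).
Context (mp : forall w, measurable (D `&` p @^-1` [set w])).

Lemma measurable_preimage_finite (Y : set W) : measurable (D `&` p @^-1` Y).
Proof.
rewrite (_ : D `&` _ = \bigcup_(w in p @` D `&` Y) (D `&` p @^-1` [set w])).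
  by apply: fin_bigcup_measurable => //; exact: finite_setIl.
apply/seteqP; split => [x [Dx Yx]|x [w [_ Yw] [Dx pxw]]].
  by exists (p x) => //; split => //; exists x.
by split => //=; rewrite pxw.
Qed.

Lemma measurable_fun_finite d' (U : measurableType d') (g : W -> U) :
  measurable_fun D (g \o p).
Proof. by move=> _ B mB; exact: (measurable_preimage_finite (g @^-1` B)). Qed.

Lemma measure_preimage_finite (Y : set W) :
  mu (D `&` p @^-1` Y) = \sum_(w \in p @` D `&` Y) mu (D `&` p @^-1` [set w]).
Proof.
rewrite -measure_fin_bigcup//; last 2 first.
- exact: finite_setIl.
- by move=> v w _ _ [x [[_ <-] [_ <-]]].
congr (mu _); apply/seteqP; split => [x [Dx Yx]|x [w [_ Yw] [Dx pxw]]].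
  by exists (p x) => //; split => //; exists x.
by split => //=; rewrite pxw.
Qed.

(** On [D], [g \o p] is the finite sum of the indicators of the fibers of [p] weighted by [g], and
    nonnegativity lets integral and sum be exchanged, even over fibers of infinite measure. *)
Lemma ge0_integral_finite (g : W -> R) : (forall w, (0 <= g w)%R) ->
  \int[mu]_(x in D) (g (p x))%:E =
  \sum_(w \in p @` D) (g w)%:E * mu (D `&` p @^-1` [set w]).
Proof.
move=> g0; have mD : measurable D.
  by rewrite -[D]setIT -(preimage_setT p); exact: measurable_preimage_finite.
pose h w x := (g w)%:E * (\1_(D `&` p @^-1` [set w]) x)%:E : \bar R.
transitivity (\int[mu]_(x in D) \sum_(w \in p @` D) h w x).
  apply: eq_integral => x /set_mem Dx.
  rewrite (fsbigD1 (p x))//=; last by exists x.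
  rewrite fsbig1 ?adde0.
    by rewrite /h indicE mem_set// mule1.
  move=> w [_ /= wpx]; rewrite /h indicE memNset ?mule0//.
  by move=> -[_ /= pxw]; exact: wpx.
rewrite ge0_integral_fsum//; last 2 first.
- by move=> w; apply: measurable_funeM; exact/measurable_EFinP/measurable_indic.
- by move=> w x _; rewrite mule_ge0 ?lee_fin.
apply: eq_fsbigr => w _; rewrite ge0_integralZl//.
- by rewrite integral_indic// setIAC setIid.
- exact/measurable_EFinP/measurable_indic.
- by rewrite lee_fin.
Qed.

End finitely_valued.

(** * Integrals of simple functions computed on a finer partition *)

Section simple.
Context d (T : measurableType d) (R : realType) (mu : {measure set T -> \bar R}).
Context (E : normedModType R) (D : set T).

Lemma simple_on_comp (W : choiceType) (p : T -> W) (h : W -> E) :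
  finite_set (p @` D) -> (forall w, measurable (D `&` p @^-1` [set w])) ->
  simple_on D (h \o p).
Proof.
move=> finp mp; split; first by rewrite -image_comp; exact: finite_image.
by move=> v; exact: (measurable_preimage_finite finp mp (h @^-1` [set v])).
Qed.

(** The fiber of [h \o p] over [v] is the disjoint union of the fibers of [p] over those [w] with
    [h w = v], so additivity of [mu] regroups the sum. This allows two simple functions to be
    integrated over one common partition. *)
Lemma simple_integral_comp (W : choiceType) (p : T -> W) (h : W -> E) :
  finite_set (p @` D) -> (forall w, measurable (D `&` p @^-1` [set w])) ->
  (forall w, h w != 0 -> (mu (D `&` p @^-1` [set w]) < +oo)%E) ->
  simple_integral mu D (h \o p) =
  \sum_(w \in p @` D) fine (mu (D `&` p @^-1` [set w])) *: h w.
Proof.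
move=> finp mp foo; have finhp : finite_set ((h \o p) @` D).
  by rewrite -image_comp; exact: finite_image.
transitivity (\sum_(v \in (h \o p) @` D) \sum_(w \in p @` D)
    if h w == v then fine (mu (D `&` p @^-1` [set w])) *: h w else 0).
  (* The value 0 is split off: its fibers may have infinite measure, where [fine] is not additive,
     but both sides vanish there. *)
  apply: eq_fsbigr => v _; have [->|v0] := eqVneq v 0.
    by rewrite scaler0 fsbig1// => w _; case: eqP => // ->; rewrite scaler0.
  rewrite (measure_preimage_finite _ finp mp (h @^-1` [set v])).
  rewrite fsbig_finite/=; last exact: finite_setIl.
  rewrite big_seq -sum_fine; last first.
    move=> w; rewrite in_fset_set; last exact: finite_setIl.
    by move=> /set_mem[_ /= hwv]; rewrite ge0_fin_numE// foo// hwv.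
  rewrite -big_seq scaler_suml -fsbig_finite; last exact: finite_setIl.
  rewrite fsbig_mkcondr; apply: eq_fsbigr => w _.
  rewrite (_ : (w \in _) = (h w == v)); first by case: eqP => // ->.
  by apply/idP/eqP => [/set_mem//|hwv]; exact/mem_set.
(* After the exchange, only the term [v = h w] survives in the inner sum. *)
rewrite exchange_fsbig//; apply: eq_fsbigr => w /set_mem[x Dx <-].
rewrite (fsbigD1 (h (p x)))//=; last by exists x.
by rewrite eqxx fsbig1 ?addr0// => v [_ /= /eqP]; rewrite eq_sym => /negbTE ->.
Qed.

End simple.

(** * Basic properties of the Bochner integral *)

Section bochner_theory.
Context d (T : measurableType d) (R : realType) (mu : {measure set T -> \bar R}).
Context (E : normedModType R) (D : set T).
Implicit Types (s t f : T -> E).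

Lemma finite_image_pair s t : simple_on D s -> simple_on D t ->
  finite_set ((fun x => (s x, t x)) @` D).
Proof.
move=> [fs _] [ft _]; apply: sub_finite_set (finite_setX fs ft).
by move=> _ [x Dx <-]; split; exists x.
Qed.

Lemma measurable_fiber_pair s t (w : E * E) : simple_on D s -> simple_on D t ->
  measurable (D `&` (fun x => (s x, t x)) @^-1` [set w]).
Proof.
move=> [_ ms] [_ mt]; rewrite (_ : _ `&` _ =
  (D `&` s @^-1` [set w.1]) `&` (D `&` t @^-1` [set w.2])).
  exact: measurableI.
apply/seteqP; split => [x [Dx <-]//|x [[Dx sx] [_ tx]]].
by split => //=; rewrite (surjective_pairing w) -sx -tx.
Qed.

(* Both integrals are computed on the common refinement of the two partitions,
   the fibers of [x |-> (s x, t x)]. *)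
Lemma simple_integral_dist s t :
  integrable_simple_on mu D s -> integrable_simple_on mu D t ->
  (`|simple_integral mu D s - simple_integral mu D t|%:E <=
   \int[mu]_(x in D) `|s x - t x|%:E)%E.
Proof.
move=> [ss s_oo] [st t_oo]; pose p x := (s x, t x).
have finp : finite_set (p @` D) by exact: finite_image_pair.
have mp w : measurable (D `&` p @^-1` [set w]) by exact: measurable_fiber_pair.
have p1 w : w.1 != 0 -> (mu (D `&` p @^-1` [set w]) < +oo)%E.
  move=> /s_oo; apply: le_lt_trans; apply: le_measure; rewrite ?inE//.
    exact: ss.2.
  by move=> x [Dx <-].
have p2 w : w.2 != 0 -> (mu (D `&` p @^-1` [set w]) < +oo)%E.
  move=> /t_oo; apply: le_lt_trans; apply: le_measure; rewrite ?inE//.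
    exact: st.2.
  by move=> x [Dx <-].
rewrite (simple_integral_comp finp mp p1) (simple_integral_comp finp mp p2).
rewrite (ge0_integral_finite mu finp mp (g := fun w => `|w.1 - w.2|))//.
rewrite !fsbig_finite//= -sumrB.
set r := finmap.enum_fset (fset_set (p @` D)).
rewrite (le_trans (y := (\sum_(w <- r)
  (`|w.1 - w.2| * fine (mu (D `&` p @^-1` [set w]))))%:E))//.
  rewrite lee_fin (le_trans (ler_norm_sum _ _ _))//; apply: ler_sum => w _.
  by rewrite -scalerBr normrZ ger0_norm ?fine_ge0// mulrC.
rewrite -sumEFin lee_sum// => w _; rewrite EFinM.
(* A fiber of infinite measure can only lie over (0, 0), where the coefficient vanishes; off the
   diagonal one coordinate is nonzero, so the measure is finite and [fine] loses nothing. *)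
have [w12|w12] := eqVneq w.1 w.2; first by rewrite w12 subrr normr0 !mul0e.
rewrite fineK// ge0_fin_numE//; have [w10|] := eqVneq w.1 0; last exact: p1.
by apply: p2; rewrite -w10 eq_sym.
Qed.

Lemma simple_on_cst0 : measurable D -> simple_on D (cst 0 : T -> E).
Proof.
move=> mD; split; first by apply: sub_finite_set (finite_set1 0) => _ [x _ <-].
move=> v; have [->|v0] := eqVneq v 0.
  by rewrite preimage_cst mem_set// setIT.
by rewrite preimage_cst memNset ?setI0// => /= /esym/eqP; exact/negP.
Qed.

Lemma integrable_simple_on_cst0 : measurable D ->
  integrable_simple_on mu D (cst 0 : T -> E).
Proof.
move=> mD; split; first exact: simple_on_cst0.
move=> v v0; rewrite preimage_cst memNset ?setI0 ?measure0//.
by move=> /= /esym/eqP; exact/negP.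
Qed.

Lemma simple_integral_cst0 : simple_integral mu D (cst 0) = 0 :> E.
Proof. by rewrite /simple_integral fsbig1// => _ [x _ <-]; rewrite scaler0. Qed.

Lemma measurable_norm_simpleB s t : simple_on D s -> simple_on D t ->
  measurable_fun D (fun x => `|s x - t x|%:E).
Proof.
move=> ss st.
exact: (@measurable_fun_finite _ _ _ _ _ (finite_image_pair ss st)
  (fun w => measurable_fiber_pair w ss st) _ _ (fun w => `|w.1 - w.2|%:E)).
Qed.

(* Completeness is needed because [f] is only an a.e. limit. *)
Lemma measurable_normB f s : measure_is_complete mu ->
  strongly_measurable mu D f -> simple_on D s ->
  measurable_fun D (fun x => `|f x - s x|%:E).
Proof.
move=> cmu [t st tf] ss; pose g k x := `|t k x - s x|%:E.
have mg k : measurable_fun D (g k) by exact: measurable_norm_simpleB.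
(* The upper limit of the [g k] is measurable on [D] and agrees with the target wherever [t k x]
   converges to [f x]. *)
apply: (ae_measurable_fun cmu (f := fun x => limn_esup (g ^~ x))).
  case: tf => N [mN N0 NP]; exists N; split => // x /= nfx; apply: NP => /= tfx.
  apply: nfx => Dx; rewrite limn_esup_lim; apply/cvg_lim => //; apply: cvg_esups.
  apply: cvg_EFin; first exact: nearW.
  by apply: cvg_norm; apply: cvgB; [exact: tfx|exact: cvg_cst].
exact: measurable_fun_limn_esup.
Qed.

Lemma measurable_norm f : measurable D -> measure_is_complete mu ->
  strongly_measurable mu D f -> measurable_fun D (fun x => `|f x|).
Proof.
move=> mD cmu sf; apply/measurable_EFinP.
have := measurable_normB cmu sf (simple_on_cst0 mD).
by congr measurable_fun; apply/funext => x; rewrite subr0.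
Qed.

(** For approximating simple [s k], the norm of the integral of [s k] is at most the integral of
    [|s k|], by comparison with the zero function, hence at most the integral of [|f|] plus that of
    [|f - s k|]; then [k] tends to infinity. *)
Lemma le_norm_bochner_integral f : measurable D -> measure_is_complete mu ->
  strongly_measurable mu D f ->
  (`|bochner_integral mu D f|%:E <= \int[mu]_(x in D) `|f x|%:E)%E.
Proof.
move=> mD cmu sf; rewrite /bochner_integral.
(* If no limit exists, the integral is the dummy value 0 and the bound is trivial. *)
case: xgetP => [I _ [s [iss s0] sI]|_]; last first.
  by rewrite normr0 integral_ge0// => x _; rewrite lee_fin.
have mf : measurable_fun D (fun x => `|f x|%:E).
  exact/measurable_EFinP/measurable_norm.
have sIle k : (`|simple_integral mu D (s k)|%:E <=
    \int[mu]_(x in D) `|f x|%:E + \int[mu]_(x in D) `|f x - s k x|%:E)%E.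
  have mfs : measurable_fun D (fun x => `|f x - s k x|%:E).
    exact: measurable_normB (iss k).1.
  have := simple_integral_dist (iss k) (integrable_simple_on_cst0 mD).
  rewrite simple_integral_cst0 subr0 => /le_trans; apply.
  rewrite -ge0_integralD//; [|by move=> x _; rewrite lee_fin..].
  apply: ge0_le_integral => //.
  - exact: measurable_norm_simpleB (iss k).1 (simple_on_cst0 mD).
  - exact: emeasurable_funD.
  - move=> x _; rewrite /= subr0 -EFinD lee_fin -{1}(subKr (f x) (s k x)).
    exact: ler_normB.
have Ile : (\int[mu]_(x in D) `|f x|%:E + \int[mu]_(x in D) `|f x - s k x|%:E)%E
    @[k --> \oo] --> (\int[mu]_(x in D) `|f x|%:E)%E.
  (* The integral of [|f|] may be infinite here; the sum of limits is still defined because the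
     other limit is 0. *)
  rewrite -[X in _ --> X]adde0; apply: cvgeD => //; last exact: cvg_cst.
  by rewrite fin_num_adde_defl.
have nI : `|simple_integral mu D (s k)|%:E @[k --> \oo] --> `|I|%:E.
  by apply: cvg_EFin; [exact: nearW|exact: cvg_norm].
rewrite -(cvg_lim _ nI)// -(cvg_lim _ Ile)//; apply: lee_lim.
- by apply/cvg_ex; exists `|I|%:E.
- by apply/cvg_ex; eexists; exact: Ile.
- exact: nearW.
Qed.

Lemma bochner_approx_simple s : integrable_simple_on mu D s ->
  bochner_approx mu D s (fun=> s).
Proof.
move=> iss; split => //; under eq_fun do under eq_integral do rewrite subrr normr0.
by rewrite integral0; exact: cvg_cst.
Qed.

Lemma bochner_integrable_simple s : integrable_simple_on mu D s ->
  bochner_integrable mu D s.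
Proof.
move=> iss; split; last by exists (fun=> s); exact: bochner_approx_simple.
exists (fun=> s); first by move=> _; exact: iss.1.
by apply: aeW => x _; exact: cvg_cst.
Qed.

(** The constant sequence [s] is one approximation. For any other one [t], the integrals of [t k]
    and [s] differ in norm by at most the integral of [|s - t k|], which tends to 0, so the limit is
    the same. *)
Lemma bochner_integral_simple s : integrable_simple_on mu D s ->
  bochner_integral mu D s = simple_integral mu D s.
Proof.
move=> iss; rewrite /bochner_integral; case: xgetP => [I _ [t [ist t0] tI]|/(_
    (simple_integral mu D s))[]]; last first.
  exists (fun=> s); last exact: cvg_cst.
  exact: bochner_approx_simple.
apply: cvg_unique tI _ => //.
pose dist k := `|simple_integral mu D (t k) - simple_integral mu D s|%:E.
apply/subr_cvg0/norm_cvg0P; apply: (fine_cvg (f := dist)).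
apply: squeeze_cvge (cvg_cst 0%E) t0; apply: nearW => k.
by rewrite lee_fin normr_ge0 /dist distrC; exact: simple_integral_dist.
Qed.

End bochner_theory.

(** * The weighted inequality over a general measure *)

Section weighted_norm_inequality.
Context d (T : measurableType d) (R : realType) (mu : {measure set T -> \bar R}).
Context (E : normedModType R) (D : set T) (u : T -> R).
Context (mD : measurable D) (mu_u : measurable_fun D u).

(** * Test functions: the indicator of [B] times a vector [e] *)

Section indicator.
Context (B : set T) (e : E).
Context (mB : measurable B) (BD : B `<=` D) (B_oo : (mu B < +oo)%E).

Let finB : finite_set ((\1_B : T -> R) @` D).
Proof.
apply: (@sub_finite_set _ _ [set 0; 1]); last exact: finite_set2.
by move=> _ [x _ <-]; rewrite indicE; case: (x \in B); [right|left].
Qed.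

Let mindicB (r : R) : measurable (D `&` (\1_B : T -> R) @^-1` [set r]).
Proof. by apply: (measurable_funS measurableT) => //; exact: measurable_indic. Qed.

Let indicB_oo (r : R) : r *: e != 0 ->
  (mu (D `&` (\1_B : T -> R) @^-1` [set r]) < +oo)%E.
Proof.
move=> re0; apply: le_lt_trans B_oo; apply: le_measure; rewrite ?inE//.
move=> x [_ /=]; rewrite indicE; case: (boolP (x \in B)) => [/set_mem//|_].
by move=> r0; rewrite -r0 scale0r eqxx in re0.
Qed.

Lemma integrable_simple_on_indic :
  integrable_simple_on mu D (fun x => \1_B x *: e).
Proof.
split; first exact: (simple_on_comp (fun r : R => r *: e) finB mindicB).
move=> v v0; apply: le_lt_trans B_oo; apply: le_measure; rewrite ?inE//.
  exact: (simple_on_comp (fun r : R => r *: e) finB mindicB).2.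
move=> x [_ /=]; rewrite indicE; case: (boolP (x \in B)) => [/set_mem//|_].
by rewrite scale0r => v0'; rewrite -v0' eqxx in v0.
Qed.

Lemma simple_integral_indic :
  simple_integral mu D (fun x => \1_B x *: e) = fine (mu B) *: e.
Proof.
rewrite (simple_integral_comp (h := fun r : R => r *: e) finB mindicB)//.
pose F r := fine (mu (D `&` (\1_B : T -> R) @^-1` [set r])) *: (r *: e).
have F1 : F 1 = fine (mu B) *: e.
  rewrite /F scale1r (_ : D `&` _ = B)//.
  apply/seteqP; split => [x [_ /=]|x Bx].
    rewrite indicE; case: (boolP (x \in B)) => [/set_mem//|_ /eqP].
    by rewrite eq_sym oner_eq0.
  by split => /=; [exact: BD|rewrite indicE mem_set].
(* Which of the values 0 and 1 the indicator takes on [D] depends on [B], so both sides are widened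
   to sums over {0, 1}: a value not taken has an empty fiber, and [F 0 = 0]. *)
rewrite -F1 -(@fsbig_set1 _ 0 +%R _ 1 F).
have FN r : D `&` \1_B @^-1` [set r] = set0 -> F r = 0.
  by rewrite /F => ->; rewrite measure0 scale0r.
rewrite (fsbig_widen _ [set 0; 1])//=; last 2 first.
- by move=> _ [x _ <-]; rewrite indicE; case: (x \in B); [right|left].
- move=> r [_ /= nr]; apply: FN; apply/seteqP; split => // x [Dx /= xr].
  by apply: nr; exists x.
rewrite [RHS](fsbig_widen _ [set 0; 1])//= => r [[/= ->|//] _].
by rewrite /= /F scale0r scaler0.
Qed.

End indicator.

Lemma measure0_of_weighted_norm_inequality (e : E) (c : R) (B : set T) :
  e != 0 -> 0 <= c < 1 -> measurable B -> B `<=` D -> (mu B < +oo)%E ->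
  (forall x, B x -> u x <= c) ->
  (forall f : T -> E, bochner_integrable mu D f ->
     (`|bochner_integral mu D f|%:E <= \int[mu]_(x in D) (u x * `|f x|)%:E)%E) ->
  mu B = 0%E.
Proof.
move=> e0 /andP[c0 c1] mB BD B_oo uc ineq.
have iB := integrable_simple_on_indic e mB B_oo.
have := ineq _ (bochner_integrable_simple iB).
rewrite (bochner_integral_simple iB) (simple_integral_indic e mB BD B_oo).
have -> : (\int[mu]_(x in D) (u x * `|\1_B x *: e|)%:E =
           \int[mu]_(x in D) ((u x * `|e|) * \1_B x)%:E)%E.
  apply: eq_integral => x _; rewrite normrZ indicE.
  by case: (x \in B); rewrite ?(normr1, normr0, mul1r, mul0r, mulr0, mulr1).
set g := fun x => ((u x * `|e|) * \1_B x)%:E.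
have mg : measurable_fun D g.
  apply/measurable_EFinP; apply: measurable_funM.
    by apply: measurable_funM => //; exact: measurable_cst.
  exact: measurable_indic.
(* As [u] may be unbounded below on [B], the negative part of [g] is simply dropped; the positive
   part is at most [c * |e|] on [B] because [0 <= c], and 0 elsewhere. *)
have : (\int[mu]_(x in D) g x <= (c * `|e|)%:E * mu B)%E.
  rewrite integralE; apply: (@le_trans _ _ (\int[mu]_(x in D) g^\+ x)%E).
    rewrite -[leRHS]sube0 leeB// integral_ge0// => x _.
  rewrite -(setIidl BD) -integral_indic// -ge0_integralZl//; last 2 first.
  - exact/measurable_EFinP/measurable_indic.
  - by rewrite lee_fin mulr_ge0.
  apply: ge0_le_integral => //.
  - exact: measurable_funepos.
  - by apply: measurable_funeM; exact/measurable_EFinP/measurable_indic.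
  move=> x Dx; rewrite funeposE /g indicE; case: (boolP (x \in B)) => [Bx|_].
    rewrite mulr1 mule1 ge_max !lee_fin mulr_ge0// andbT ler_wpM2r// uc//.
    exact: set_mem.
  by rewrite mulr0 mule0 maxxx.
move=> gle /le_trans /(_ gle); rewrite normrZ ger0_norm ?fine_ge0//.
rewrite -[in X in (_ <= X)%E](@fineK _ (mu B)) ?ge0_fin_numE// -EFinM lee_fin.
(* Cancelling [|e|] leaves [m <= c * m] for the finite number [m = fine (mu B)]; since [c < 1], this
   forces [m = 0]. *)
rewrite mulrAC ler_pM2r ?normr_gt0// => le_c; apply/eqP.
rewrite -(@fineK _ (mu B)) ?ge0_fin_numE// eqe.
have : 0 <= fine (mu B) by exact: fine_ge0.
by rewrite le_eqVlt => /predU1P[<-//|m0]; move: le_c; rewrite ler_pMl// leNgt c1.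
Qed.

Lemma ae_ge1_of_weighted_norm_inequality (e : E) :
  sigma_finite setT mu -> e != 0 ->
  (forall f : T -> E, bochner_integrable mu D f ->
     (`|bochner_integral mu D f|%:E <= \int[mu]_(x in D) (u x * `|f x|)%:E)%E) ->
  {ae mu, forall x, D x -> 1 <= u x}.
Proof.
(* These thresholds increase to 1 and start at [c 0 = 0], so each lies in [0, 1). *)
move=> [F TF Foo] e0 ineq; pose c k : R := 1 - k.+1%:R^-1.
pose A k := D `&` [set x | u x <= c k].
have mA k : measurable (A k).
  rewrite (_ : A k = D `&` u @^-1` `]-oo, c k]); last first.
    by apply/seteqP; split => x [Dx] /=; rewrite in_itv.
  exact: mu_u.
(* Intersecting with the sets [F j] of finite measure gives test sets of finite measure that still
   cover the part of [D] where [u < 1]. *)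
suff : mu.-negligible (\bigcup_k \bigcup_j (A k `&` F j)).
  apply: negligibleS => x /= /not_implyP[Dx /negP]; rewrite -ltNge => ux1.
  have [k uk] : exists k, u x <= c k.
    (* With this [k], [k + 1] exceeds [1 / (1 - u x)], hence [1 / (k + 1) <= 1 - u x]. *)
    exists (Num.truncn (1 - u x)^-1); rewrite /c lerBrDr -lerBrDl.
    rewrite invf_ple ?posrE ?subr_gt0 ?ltr0n//.
    by apply: ltW; rewrite truncnS_gt.
  have : setT x by []; rewrite TF => -[j _ Fjx].
  by exists k => //; exists j.
apply: negligible_bigcup => k; apply: negligible_bigcup => j.
have [mF Fjoo] := Foo j; have mAF := measurableI _ _ (mA k) mF.
apply/negligibleP => //; apply: (@measure0_of_weighted_norm_inequality e (c k)) => //.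
- rewrite /c subr_ge0 invf_le1 ?ltr0n// ler1n /=.
  by rewrite ltrBlDr ltrDl invr_gt0 ltr0n.
- by move=> x [[]].
- by apply: le_lt_trans Fjoo; apply: le_measure; rewrite ?inE//; exact: subIsetr.
- by move=> x [[]].
Qed.

(** Replacing [u] by [max(u, 1)] changes the integrand only on a null subset of [D]. The new
    integrand [h] is nonnegative and dominates [|f|] everywhere, so the bound on the norm of the
    integral applies. *)
Lemma weighted_norm_inequality_of_ae_ge1 (f : T -> E) :
  measure_is_complete mu -> {ae mu, forall x, D x -> 1 <= u x} ->
  strongly_measurable mu D f ->
  integral_exists mu D (fun x => (u x * `|f x|)%:E) /\
  (`|bochner_integral mu D f|%:E <= \int[mu]_(x in D) (u x * `|f x|)%:E)%E.
Proof.
move=> cmu u1 sf; have mf := measurable_norm mD cmu sf.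
pose g x := (u x * `|f x|)%:E; pose h x := (Num.max (u x) 1 * `|f x|)%:E.
have mg : measurable_fun D g by exact/measurable_EFinP/measurable_funM.
have mh : measurable_fun D h.
  apply/measurable_EFinP/measurable_funM => //.
  by apply: measurable_maxr => //; exact: measurable_cst.
have h0 x : (0 <= h x)%E by rewrite lee_fin mulr_ge0// le_max ler01 orbT.
have gh : ae_eq mu D g h.
  case: u1 => N [mN N0 uN]; exists N; split => // x /= ghx; apply: uN => /= ux.
  by apply: ghx => Dx; rewrite /g /h max_l// ux.
split; first split => //.
  (* The negative part of [g] is a.e. equal to that of [h], which is 0. *)
  right; have [_ /ae_eq_integral ->]// := (ae_eq_funeposneg mu D g h).1 gh.
  - rewrite (eq_integral (cst 0%E)) ?integral0//.
    exact: (@ge0_funenegE _ _ D).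
  - exact: measurable_funeneg.
  - exact: measurable_funeneg.
rewrite (ae_eq_integral h)//; apply: le_trans (le_norm_bochner_integral mD cmu sf) _.
apply: ge0_le_integral => //; first exact/measurable_EFinP.
by move=> x Dx; rewrite lee_fin ler_peMl// le_max lexx orbT.
Qed.

End weighted_norm_inequality.

Unset Implicit Arguments.
Set Strict Implicit.

(** * The characterization for Lebesgue measure *)

Theorem theorem2p1 (R : realType) (n : nat) (E : completeNormedModType R)
    (E_neq0 : exists e : E, e != 0)
    (Omega : set (Rn R n)) (mOmega : measurable Omega)
    (u : Rn R n -> R) (mu_u : measurable_fun Omega u) :
  (forall f : Rn R n -> E, bochner_integrable (@lebesgue R n) Omega f ->
     integral_exists (@lebesgue R n) Omega (fun x => (u x * `|f x|)%:E) /\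
     (`|bochner_integral (@lebesgue R n) Omega f|%:E <=
      \int[@lebesgue R n]_(x in Omega) (u x * `|f x|)%:E)%E)
  <->
  {ae @lebesgue R n, forall x, Omega x -> 1 <= u x}.
Proof.
split=> [ineq|u1 f [sf _]].
  have [e e0] := E_neq0; apply: ae_ge1_of_weighted_norm_inequality e0 _ => //.
    exact: sigma_finiteT.
  by move=> f /ineq[].
apply: weighted_norm_inequality_of_ae_ge1 => //.
(* Lebesgue measure is complete because its measurable sets are the Caratheodory measurable ones. *)
exact: measure_is_complete_caratheodory.
Qed.
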